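(* Let $\mathfrak g$ be a perfect Lie algebra over a field $F$ and let $$0\to K\to L\to\mathfrak g\to0$$ be a central extension of Lie triple systems of $\mathfrak g$, where $\mathfrak g$ is considered as a Lie triple system via $\{x,y,z\}=[x,[y,z]]$. Then there is a Leibniz algebra structure $[-,-]:L\otimes L\to L$ on $L$ such that the original Lie triple system structure on $L$ is given by the Leibniz bracket: $$\{x,y,z\}=[x,[y,z]]\quad\text{for all }x,y,z\in L.$$
   Context: All vector spaces and homomorphisms are over the field $F$ (of any characteristic and any dimension). A Lie algebra is a vector space with a bilinear bracket satisfying $[x,x]=0$ and the Jacobi identity. It is perfect if $\mathfrak g=[\mathfrak g,\mathfrak g]$. A (right) Leibniz algebra is a vector space $\mathfrak h$ with a bilinear bracket satisfying $[x,[y,z]]=[[x,y],z]-[[x,z],y]$ for all $x,y,z\in\mathfrak h$. A Lie triple system is a vector space $L$ with a trilinear bracket $\{-,-,-\}:L\otimes L\otimes L\to L$ such that for all $x,y,z,a,b\in L$: $\{x,y,y\}=0$; $\{x,y,z\}+\{y,z,x\}+\{z,x,y\}=0$; $\{\{x,y,z\},a,b\}=\{\{x,a,b\},y,z\}+\{x,\{y,a,b\},z\}+\{x,y,\{z,a,b\}\}$. A central extension of a Lie triple system $\mathfrak g$ is a short exact sequence of Lie triple systems $0\to K\to L\to\mathfrak g\to 0$ with $\{L,L,K\}=0$ (this implies $\{L,K,L\}=\{K,L,L\}=0$). *)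

(* Defs.v *)
(* Vector spaces of arbitrary dimension are modules
   [V : lmodType F] over a field [F : fieldType] of arbitrary characteristic. *)
From HB Require Import structures.
From mathcomp Require Import all_boot all_order all_algebra.

Set Implicit Arguments.
Unset Strict Implicit.
Unset Printing Implicit Defensive.

Import GRing.Theory.
Local Open Scope ring_scope.

Record lie_algebra (F : fieldType) (V : lmodType F)
    (br : {bilinear V -> V -> V}) : Prop := LieAlgebra {
  lie_alternating : forall x, br x x = 0;
  lie_jacobi : forall x y z,
    br x (br y z) + br y (br z x) + br z (br x y) = 0
}.

(* [x] lies in [V, V], the linear span of all brackets. *)
Definition in_derived (F : fieldType) (V : lmodType F)
    (br : {bilinear V -> V -> V}) (x : V) : Prop :=
  exists (n : nat) (a : 'I_n -> F) (y z : 'I_n -> V),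
    x = \sum_(i < n) a i *: br (y i) (z i).

Definition perfect (F : fieldType) (V : lmodType F)
    (br : {bilinear V -> V -> V}) : Prop :=
  forall x, in_derived br x.

(* Right Leibniz identity: each [br^~ z] is a derivation of [br]. *)
Definition leibniz_algebra (F : fieldType) (V : lmodType F)
    (br : {bilinear V -> V -> V}) : Prop :=
  forall x y z, br x (br y z) = br (br x y) z - br (br x z) y.

Record trilinear (F : fieldType) (V : lmodType F) (t : V -> V -> V -> V) : Prop
    := Trilinear {
  trilinear1 : forall y z, linear (fun x => t x y z);
  trilinear2 : forall x z, linear (fun y => t x y z);
  trilinear3 : forall x y, linear (fun z => t x y z)
}.

Record lie_triple_system (F : fieldType) (V : lmodType F)
    (t : V -> V -> V -> V) : Prop := LieTripleSystem {
  lts_trilinear : trilinear t;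
  lts_alternating : forall x y, t x y y = 0;
  lts_cyclic : forall x y z, t x y z + t y z x + t z x y = 0;
  lts_derivation : forall x y z a b,
    t (t x y z) a b = t (t x a b) y z + t x (t y a b) z + t x y (t z a b)
}.

Definition lts_of_lie (F : fieldType) (V : lmodType F)
    (br : {bilinear V -> V -> V}) (x y z : V) : V := br x (br y z).

Definition lts_morphism (F : fieldType) (V W : lmodType F)
    (t : V -> V -> V -> V) (t' : W -> W -> W -> W) (f : {linear V -> W}) : Prop
  := forall x y z, f (t x y z) = t' (f x) (f y) (f z).

(* 0 -> K --iota--> L --pi--> G -> 0 *)
Record lts_central_extension (F : fieldType) (K L G : lmodType F)
    (tK : K -> K -> K -> K) (tL : L -> L -> L -> L) (tG : G -> G -> G -> G)
    (iota : {linear K -> L}) (pi : {linear L -> G}) : Prop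
    := LtsCentralExtension {
  ext_ltsK : lie_triple_system tK;
  ext_ltsL : lie_triple_system tL;
  ext_ltsG : lie_triple_system tG;
  ext_iota_morph : lts_morphism tK tL iota;
  ext_pi_morph : lts_morphism tL tG pi;
  ext_iota_inj : injective iota;
  ext_exact : forall x, pi x = 0 <-> exists k, iota k = x;
  ext_pi_surj : forall g, exists x, pi x = g;
  ext_central : forall x y k, tL x y (iota k) = 0
}.

Lemma lie_anti (F : fieldType) (V : lmodType F) (br : {bilinear V -> V -> V}) :
  lie_algebra br -> forall x y, br x y = - br y x.
Proof.
move=> H x y; apply/eqP; rewrite -addr_eq0; apply/eqP.
have := lie_alternating H (x + y).
by rewrite linearDl !linearDr /= !(lie_alternating H) add0r addr0.
Qed.

Lemma lie_lts (F : fieldType) (V : lmodType F) (br : {bilinear V -> V -> V}) :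
  lie_algebra br -> lie_triple_system (lts_of_lie br).
Proof.
move=> H; have anti := lie_anti H.
have der x y w : br (br x y) w = br (br x w) y + br x (br y w).
  have /eqP := lie_jacobi H x y w.
  rewrite (anti w (br x y)) (anti w x) linearNr (anti y (br x w)) opprK.
  by rewrite subr_eq0 addrC => /eqP.
split; rewrite /lts_of_lie.
- split=> [y z|x z|x y] a u v.
  + exact: linearPl.
  + by rewrite linearPl linearPr.
  + by rewrite !linearPr.
- by move=> x y; rewrite (lie_alternating H) linear0r.
- exact: lie_jacobi H.
- by move=> x y z a b; rewrite der -addrA -linearDr /= (der y z).
Qed.

(* Main.v *)
Require Import Defs.
From HB Require Import structures.
From mathcomp Require Import all_boot all_order all_algebra.
From Stdlib Require Import IndefiniteDescription.

Set Implicit Arguments.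
Unset Strict Implicit.

Import GRing.Theory.
Local Open Scope ring_scope.

(** Centrality makes the triple product of [L] depend only on the images of its
    arguments in [G], so it comes from a trilinear [T : G -> G -> G -> L] lifting
    [[a, [b, c]]] ([central_ext_factor]).  It suffices to find a bilinear [B : G -> G -> L] with
    [T a b c = B a [b, c]], since the bracket [B (pi x) (pi y)] on [L] then
    lies over the bracket of [G].

    The issue is whether [T a b c] depends only on [[b, c]].  Perfectness
    gives this: every [a] is a combination of double brackets [[p, [q, r]]],
    and for such [a] the derivation axiom of triple systems reads
      [T [p, [q, r]] b c
         = T [p, w] q r + T p [q, w] r + T p q [r, w]] with [w = [b, c]],
    whose right-hand side is linear in [w] and makes sense for every [w].
    It is the derivative of [T] along the derivation [[-, w]] of [G]; hence
    [B [p, [q, r]] w] is this derivative ([factor_double_bracket]).  The Leibniz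
    identity for [B] then says that taking this derivative turns
    [[-, [b, c]]], the commutator of [[-, b]] and [[-, c]], into a commutator
    of derivatives: the mixed terms, where [b] and [c] act on different
    arguments, cancel ([factor_leibniz]). *)

(** * Linear maps *)

Lemma linear_add {F : fieldType} {V W : lmodType F} {f : V -> W} :
  linear f -> {morph f : x y / x + y}.
Proof. by move=> lf x y; rewrite -[x]scale1r lf !scale1r. Qed.

Lemma linear_sub {F : fieldType} {V W : lmodType F} {f : V -> W} :
  linear f -> {morph f : x y / x - y}.
Proof. by move=> lf x y; rewrite addrC -scaleN1r lf scaleN1r addrC. Qed.

Lemma linear_comb (F : fieldType) (V W : lmodType F) (f g : V -> W) (k : F) :
  linear f -> linear g -> linear (fun x => k *: f x + g x).
Proof.
move=> lf lg c x y /=.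
by rewrite lf lg !scalerDr !scalerA [k * c]mulrC addrACA.
Qed.

Lemma linear_sum2 (F : fieldType) (V W : lmodType F) (f g : V -> W) :
  linear f -> linear g -> linear (fun x => f x + g x).
Proof. by move=> lf lg c x y /=; rewrite lf lg scalerDr addrACA. Qed.

Definition trilinear_map (F : fieldType) (V W : lmodType F)
    (T : V -> V -> V -> W) : Prop :=
  [/\ forall b c, linear (fun a => T a b c),
      forall a c, linear (fun b => T a b c)
    & forall a b, linear (T a b)].

(** * Perfect Lie algebras *)

(** The predicates [P] below are subspaces: [0] is the bracket [lie 0 0]. *)
Lemma perfect_ind (F : fieldType) (G : lmodType F)
    (lie : {bilinear G -> G -> G}) (perfG : perfect lie) (P : G -> Prop) :
  (forall k x y, P x -> P y -> P (k *: x + y)) ->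
  (forall y z, P (lie y z)) -> forall x, P x.
Proof.
move=> Pcomb Plie x; have [n [a [y [z ->]]]] := perfG x.
apply: (big_rec P) => [|i u _ Pu]; last exact: Pcomb.
by rewrite -(linear0r lie 0).
Qed.

Lemma perfect_double_ind (F : fieldType) (G : lmodType F)
    (lie : {bilinear G -> G -> G}) (perfG : perfect lie) (P : G -> Prop) :
  (forall k x y, P x -> P y -> P (k *: x + y)) ->
  (forall p q r, P (lie p (lie q r))) -> forall x, P x.
Proof.
move=> Pcomb Plie; apply: (perfect_ind perfG) => // p.
apply: (perfect_ind perfG) => // k x y Px Py.
by rewrite linearPr; apply: Pcomb.
Qed.

Lemma perfect_linear_eq {F : fieldType} {G W : lmodType F}
    {lie : {bilinear G -> G -> G}} (perfG : perfect lie) (f g : G -> W) :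
  linear f -> linear g -> (forall y z, f (lie y z) = g (lie y z)) -> f =1 g.
Proof.
move=> lf lg fg; apply: (perfect_ind perfG) => // k x y fgx fgy.
by rewrite lf lg fgx fgy.
Qed.

Lemma lie_leibniz {F : fieldType} {G : lmodType F}
    {lie : {bilinear G -> G -> G}} : lie_algebra lie -> leibniz_algebra lie.
Proof.
move=> lieG x y z; have anti := lie_anti lieG.
have /eqP := lie_jacobi lieG x y z.
rewrite (anti z (lie x y)) (anti z x) linearNr (anti y (lie x z)) opprK.
by rewrite -addrA addr_eq0 opprD opprK addrC => /eqP.
Qed.

Lemma lie_derivation {F : fieldType} {G : lmodType F}
    {lie : {bilinear G -> G -> G}} (lieG : lie_algebra lie) x y z :
  lie (lie x y) z = lie (lie x z) y + lie x (lie y z).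
Proof. by rewrite (lie_leibniz lieG x) addrC subrK. Qed.

(** * Factoring a trilinear map through the bracket *)

(** The derivative of [T] along the derivation [[-, w]]. *)
Definition deriv3 {F : fieldType} {G W : lmodType F} (lie : G -> G -> G)
    (T : G -> G -> G -> W) (w p q r : G) : W :=
  T (lie p w) q r + T p (lie q w) r + T p q (lie r w).

Lemma linear_deriv3 (F : fieldType) (G W : lmodType F)
    (lie : {bilinear G -> G -> G}) (T : G -> G -> G -> W) (p q r : G) :
  trilinear_map T -> linear (fun w => deriv3 lie T w p q r).
Proof.
case=> T1 T2 T3; do 2?[apply: linear_sum2]; move=> k u v /=.
- by rewrite linearPr T1.
- by rewrite linearPr T2.
- by rewrite linearPr T3.
Qed.

(** The mixed terms, where [b] and [c] act on different arguments of [T],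
    occur in both second derivatives; the others combine by the Leibniz
    identity of [G]. *)
Lemma deriv3_bracket (F : fieldType) (G W : lmodType F)
    (lie : {bilinear G -> G -> G}) (T : G -> G -> G -> W) (b c p q r : G) :
  lie_algebra lie -> trilinear_map T ->
  deriv3 lie T (lie b c) p q r =
    deriv3 lie (deriv3 lie T c) b p q r - deriv3 lie (deriv3 lie T b) c p q r.
Proof.
move=> lieG [T1 T2 T3]; rewrite /deriv3 !(lie_leibniz lieG _ b c).
rewrite (linear_sub (T1 _ _)) (linear_sub (T2 _ _)) (linear_sub (T3 _ _)).
set d1 := T (lie (lie p b) c) q r; set d1' := T (lie (lie p c) b) q r.
set d2 := T p (lie (lie q b) c) r; set d2' := T p (lie (lie q c) b) r.
set d3 := T p q (lie (lie r b) c); set d3' := T p q (lie (lie r c) b).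
set s12 := T (lie p b) (lie q c) r; set s21 := T (lie p c) (lie q b) r.
set s13 := T (lie p b) q (lie r c); set s31 := T (lie p c) q (lie r b).
set s23 := T p (lie q b) (lie r c); set s32 := T p (lie q c) (lie r b).
have -> : d1 + s12 + s13 + (s21 + d2 + s23) + (s31 + s32 + d3) =
  (d1 + d2 + d3) + (s12 + s13 + s21 + s23 + s31 + s32).
  by rewrite [LHS](AC ((3*3)*3) ((1*5*9)*(2*3*4*6*7*8))).
have -> : d1' + s21 + s31 + (s12 + d2' + s32) + (s13 + s23 + d3') =
  (d1' + d2' + d3') + (s12 + s13 + s21 + s23 + s31 + s32).
  by rewrite [LHS](AC ((3*3)*3) ((1*5*9)*(4*7*2*8*3*6))).
rewrite opprD [RHS]addrACA subrr addr0 !opprD.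
by rewrite [RHS](AC (3*3) (1*4*(2*5)*(3*6))).
Qed.

(** The factorization of [T a] through the bracket exists for a double bracket
    [a] by the derivation axiom, and for all [a] because such factorizations
    can be combined linearly. *)
Lemma factor_exists (F : fieldType) (G W : lmodType F)
    (lie : {bilinear G -> G -> G}) (T : G -> G -> G -> W) :
  perfect lie -> trilinear_map T ->
  (forall p q r b c, T (lie p (lie q r)) b c = deriv3 lie T (lie b c) p q r) ->
  exists B : G -> G -> W,
    [/\ forall w, linear (B^~ w), forall a, linear (B a)
      & forall a b c, T a b c = B a (lie b c)].
Proof.
move=> perfG triT derT; have [T1 _ _] := triT.
have fac a : exists f : G -> W,
    linear f /\ forall b c, T a b c = f (lie b c).
  move: a; apply: (perfect_double_ind perfG).
    move=> k x y [f [lf Tf]] [g [lg Tg]].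
    exists (fun w => k *: f w + g w); split; first exact: linear_comb.
    by move=> b c; rewrite T1 Tf Tg.
  move=> p q r; exists (fun w => deriv3 lie T w p q r); split=> //.
  exact: linear_deriv3.
have [B BP] := functional_choice _ fac.
have linB a : linear (B a) by case: (BP a).
have TB a b c : T a b c = B a (lie b c) by case: (BP a).
exists B; split=> // w k x y; move: w.
apply: (perfect_linear_eq perfG) => // [|b c]; first exact: linear_comb.
by rewrite -!TB T1.
Qed.

(** Both sides are linear in [w] and agree with [T] when [w] is a bracket.
    This makes [B] explicit on double brackets, hence computable everywhere. *)
Lemma factor_double_bracket (F : fieldType) (G W : lmodType F)
    (lie : {bilinear G -> G -> G}) (T : G -> G -> G -> W) (B : G -> G -> W) :
  perfect lie -> trilinear_map T ->
  (forall p q r b c, T (lie p (lie q r)) b c = deriv3 lie T (lie b c) p q r) ->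
  (forall a, linear (B a)) -> (forall a b c, T a b c = B a (lie b c)) ->
  forall p q r w, B (lie p (lie q r)) w = deriv3 lie T w p q r.
Proof.
move=> perfG triT derT linB TB p q r; apply: (perfect_linear_eq perfG) => //.
  exact: linear_deriv3.
by move=> b c; rewrite -TB derT.
Qed.

(** The identity is linear in [a].  For [a = [p, [q, r]]], expanding [[a, u]]
    by the derivation rule again gives double brackets, so each side is a
    first or second derivative of [T] at [(p, q, r)]. *)
Lemma factor_leibniz (F : fieldType) (G W : lmodType F)
    (lie : {bilinear G -> G -> G}) (T : G -> G -> G -> W) (B : G -> G -> W) :
  lie_algebra lie -> perfect lie -> trilinear_map T ->
  (forall p q r b c, T (lie p (lie q r)) b c = deriv3 lie T (lie b c) p q r) ->
  (forall w, linear (B^~ w)) -> (forall a, linear (B a)) ->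
  (forall a b c, T a b c = B a (lie b c)) ->
  forall a b c, B a (lie b c) = B (lie a b) c - B (lie a c) b.
Proof.
move=> lieG perfG triT derT linB1 linB2 TB a b c.
have BD := factor_double_bracket perfG triT derT linB2 TB.
have BDD p q r u v :
    B (lie (lie p (lie q r)) u) v = deriv3 lie (deriv3 lie T v) u p q r.
  rewrite (lie_derivation lieG p) (lie_derivation lieG q) linearDr /= addrA.
  by rewrite !(linear_add (linB1 v)) !BD.
move: a; apply: (perfect_double_ind perfG) => [k x y Ix Iy|p q r].
  by rewrite !linearPl !linB1 Ix Iy scalerBr opprD addrACA.
by rewrite BD !BDD; apply: deriv3_bracket.
Qed.

(** * Central extensions *)

(** The axioms [t x y y = 0] and the cyclic one carry centrality from the third
    argument to the second, and then to the first. *)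
Lemma central_ext_factor (F : fieldType) (G K L : lmodType F)
    (tK : K -> K -> K -> K) (tL : L -> L -> L -> L) (tG : G -> G -> G -> G)
    (iota : {linear K -> L}) (pi : {linear L -> G}) :
  lts_central_extension tK tL tG iota pi ->
  exists T : G -> G -> G -> L,
    trilinear_map T /\
    forall x y z, tL x y z = T (pi x) (pi y) (pi z).
Proof.
move=> ext; have [[t1 t2 t3] alt cyc _] := ext_ltsL ext.
have central3 x y z : pi z = 0 -> tL x y z = 0.
  by case/(ext_exact ext)=> k <-; apply: ext_central ext _ _ _.
have anti x y z : tL x y z = - tL x z y.
  have := alt x (y + z); rewrite (linear_add (t2 _ _)) !(linear_add (t3 _ _)).
  by rewrite !alt add0r addr0 => /eqP; rewrite addr_eq0 => /eqP.
have central2 x y z : pi y = 0 -> tL x y z = 0.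
  by move=> y0; rewrite anti central3 ?oppr0.
have central1 x y z : pi x = 0 -> tL x y z = 0.
  move=> x0; have := cyc x y z.
  by rewrite (central3 y z x) // (central2 z x y) // !addr0.
have pi_diff u v : pi u = pi v -> pi (u - v) = 0.
  by move=> uv; rewrite linearB /= uv subrr.
have well_def x y z x' y' z' : pi x = pi x' -> pi y = pi y' -> pi z = pi z' ->
    tL x y z = tL x' y' z'.
  move=> /pi_diff xx' /pi_diff yy' /pi_diff zz'.
  transitivity (tL x' y z).
    by apply/subr0_eq; rewrite -(linear_sub (t1 _ _)) central1.
  transitivity (tL x' y' z).
    by apply/subr0_eq; rewrite -(linear_sub (t2 _ _)) central2.
  by apply/subr0_eq; rewrite -(linear_sub (t3 _ _)) central3.
(* The section [s] is only set-theoretic: changing a lift by an element of the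
   kernel does not affect [tL], which is why the composite is trilinear. *)
have [s sK] := functional_choice _ (ext_pi_surj ext).
exists (fun a b c => tL (s a) (s b) (s c)); split; last first.
  by move=> x y z; apply: well_def; rewrite sK.
split=> [b c|a c|a b] k u v.
- by rewrite -t1; apply: well_def; rewrite ?linearP /= ?sK.
- by rewrite -t2; apply: well_def; rewrite ?linearP /= ?sK.
- by rewrite -t3; apply: well_def; rewrite ?linearP /= ?sK.
Qed.

Unset Implicit Arguments.

Theorem lemma1 (F : fieldType) (G K L : lmodType F)
    (lie : {bilinear G -> G -> G})
    (tK : K -> K -> K -> K) (tL : L -> L -> L -> L)
    (iota : {linear K -> L}) (pi : {linear L -> G})
    (lieG : lie_algebra lie) (perfG : perfect lie)
    (ext : lts_central_extension tK tL (lts_of_lie lie) iota pi) :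
  exists br : {bilinear L -> L -> L},
    leibniz_algebra br /\ forall x y z : L, tL x y z = br x (br y z).
Proof.
have [T [triT tLT]] := central_ext_factor ext.
have piT a b c : pi (T a b c) = lie a (lie b c).
  have [[x <-] [y <-]] := (ext_pi_surj ext a, ext_pi_surj ext b).
  have [z <-] := ext_pi_surj ext c.
  by rewrite -tLT (ext_pi_morph ext).
have derT p q r b c :
    T (lie p (lie q r)) b c = deriv3 lie T (lie b c) p q r.
  have [[x <-] [y <-]] := (ext_pi_surj ext p, ext_pi_surj ext q).
  have [z <-] := ext_pi_surj ext r.
  have [[u <-] [v <-]] := (ext_pi_surj ext b, ext_pi_surj ext c).
  have := lts_derivation (ext_ltsL ext) x y z u v.
  by rewrite !tLT !piT.
have [B [linB1 linB2 TB]] := factor_exists perfG triT derT.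
have leibB :=
  factor_leibniz lieG perfG triT derT linB1 linB2 TB.
have piB a : (fun w => pi (B a w)) =1 lie a.
  apply: (perfect_linear_eq perfG) => [k u v|k u v|b c].
  - by rewrite linB2 linearP.
  - by rewrite linearPr.
  - by rewrite -TB piT.
pose br0 (x y : L) := B (pi x) (pi y).
have br0l y : linear (br0^~ y) by move=> k u v; rewrite /br0 linearP linB1.
have br0r x : linear (br0 x) by move=> k u v; rewrite /br0 linearP linB2.
have bil : bilinear_for *:%R *:%R br0 by split.
pose br : {bilinear L -> L -> L} := 
  HB.pack br0 (bilinear_isBilinear.Build _ _ _ _ _ _ br0 bil).
exists br; split=> [x y z|x y z]; rewrite /= /br0 !piB.
  exact: leibB.
by rewrite tLT TB.
Qed.
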